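(* Let $f(z,w)=(p(z),q(z,w))$ be a polynomial skew product on $\mathbb{C}^2$ with $\deg p=\delta\ge 2$ and $\deg q\ge 2$, and let $(\gamma,d)$, $U=U_R$, $T_k$ and $f_0=(p_0,q_0)$ be associated with $f$ as described in the context. If $d\ge 2$, or if $d=1$ and $\delta\ne T_k$ for any $k$, then (1) for any small $\varepsilon>0$ there is $R>0$ such that $|p-p_0|<\varepsilon|p_0|$ and $|q-q_0|<\varepsilon|q_0|$ on $U$; and (2) $f(U)\subset U$ for large $R>0$.
   Context: Write $p(z)=a_\delta z^\delta+o(z^\delta)$ (as $z\to\infty$) with $a_\delta\neq0$, and $q(z,w)=\sum_{i,j\ge0}b_{ij}z^iw^j$ (a polynomial). Newton polygon: $N(q)$ is the convex hull of the union of the sets $D(i,j)=\{(x,y)\in\mathbb{R}^2: x\le i,\ y\le j\}$ over all $(i,j)$ with $b_{ij}\ne0$. Let $(n_1,m_1),\dots,(n_s,m_s)$ be the vertices of $N(q)$, with $n_1<\dots<n_s$ and $m_1>\dots>m_s$. For $1\le k\le s-1$ let $T_k$ be the $y$-intercept of the line through $(n_k,m_k)$ and $(n_{k+1},m_{k+1})$ (if $s=1$ there are no $T_k$). For $R>0$, define $(\gamma,d)$, $l_1$, $l_2$ and the region $U=U_R\subset\mathbb{C}^2$ by cases (if several cases apply, any one of them may be chosen): - Case 1: $s=1$. $(\gamma,d)=(n_1,m_1)$, $l_1=l_2^{-1}=0$, $U=\{|z|>R,\ |w|>R\}$. - Case 2: $s>1$ and $\delta\le T_1$. $(\gamma,d)=(n_1,m_1)$,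 $l_1=\frac{n_2-n_1}{m_1-m_2}$, $l_2^{-1}=0$, $U=\{|z|>R,\ |w|>R|z|^{l_1}\}$. - Case 3: $s>1$ and $T_{s-1}\le\delta$. $(\gamma,d)=(n_s,m_s)$, $l_1=0$, $l_2=\frac{n_s-n_{s-1}}{m_{s-1}-m_s}$, $U=\{R<|w|<R^{-l_2}|z|^{l_2}\}$. - Case 4: $s>2$ and $T_{k-1}\le\delta\le T_k$ for some $2\le k\le s-1$. $(\gamma,d)=(n_k,m_k)$, $l_1=\frac{n_{k+1}-n_k}{m_k-m_{k+1}}$, $l_1+l_2=\frac{n_k-n_{k-1}}{m_{k-1}-m_k}$, $U=\{R|z|^{l_1}<|w|<R^{-l_2}|z|^{l_1+l_2}\}$. Finally $f_0(z,w)=(p_0(z),q_0(z,w))=(a_\delta z^\delta,\ b_{\gamma d}z^\gamma w^d)$. *)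

(* Defs.v *)
From mathcomp Require Import all_boot all_order all_algebra.
From mathcomp Require Import all_classical all_reals all_analysis.
From mathcomp Require Import polyXY.
From mathcomp Require Export complex.

Set Implicit Arguments.
Unset Strict Implicit.
Unset Printing Implicit Defensive.

Import Order.TTheory GRing.Theory Num.Theory.

Local Open Scope classical_set_scope.
Local Open Scope ring_scope.
Local Open Scope convex_scope.

(* The modulus with values in K (the generic norm `|z| is valued in K[i]). *)
Definition cmod (K : realType) (z : K[i]) : K := ComplexField.Normc.normc z.

(* A polynomial q(z, w) is represented with z as outer and w as inner variable,
   so that b_ij = q`_i`_j and q(z, w) = q.[z, w] with the notation of polyXY. *)

Definition total_degree (F : nzRingType) (q : {poly {poly F}}) : nat :=
  \max_(i < size q) \max_(j < size (q`_i)%R | (q`_i`_j)%R != 0%R) (i + j)%N.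

Definition skew_product (F : nzRingType) (p : {poly F}) (q : {poly {poly F}})
    (x : F * F) : F * F :=
  (p.[x.1], q.[x.1, x.2]).

Definition p0 (F : nzRingType) (p : {poly F}) (delta : nat) (z : F) : F :=
  p`_delta * z ^+ delta.

Definition q0 (F : nzRingType) (q : {poly {poly F}}) (gamma d : nat)
    (z w : F) : F :=
  q`_gamma`_d * z ^+ gamma * w ^+ d.

Section NewtonPolygon.
Variable K : realType.

(* R^2, with its structure of K-vector space *)
Definition plane : lmodType K := (K^o * K^o)%type.

Definition convex_hull (A : set plane) : set plane :=
  smallest (@convex_set K plane) A.

Definition quadrant (i j : nat) : set plane :=
  [set x | x.1 <= i%:R /\ x.2 <= j%:R].

Definition newton_polygon (q : {poly {poly K[i]}}) : set plane :=
  convex_hull [set x | exists i j : nat, q`_i`_j != 0 /\ quadrant i j x].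

(* The vertices of a convex polygonal region are its extreme points. *)
Definition vertex (A : set plane) (v : plane) : Prop :=
  A v /\ forall (x y : convex_lmodType plane) (t : {i01 K}),
    A x -> A y -> 0 < t%:num < 1 -> x <| t |> y = v -> x = v /\ y = v.

(* vs = [:: (n_1, m_1); ...; (n_s, m_s)] *)
Definition newton_vertices (q : {poly {poly K[i]}}) (vs : seq (nat * nat)) :=
  sorted (fun v v' => (v.1 < v'.1) && (v'.2 < v.2))%N vs /\
  forall x : plane, vertex (newton_polygon q) x <->
    exists2 v, v \in vs & x = (v.1%:R, v.2%:R).

(* Indices start from 0: vtx_n vs k is n_(k+1), intercept vs k is T_(k+1), etc. *)
Definition vtx_n (vs : seq (nat * nat)) (k : nat) : nat := (nth (0, 0) vs k).1%N.
Definition vtx_m (vs : seq (nat * nat)) (k : nat) : nat := (nth (0, 0) vs k).2%N.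

(* y-intercept of the line through the vertices of index k and k.+1 *)
Definition intercept (vs : seq (nat * nat)) (k : nat) : K :=
  (vtx_m vs k)%:R - (vtx_n vs k)%:R *
    (((vtx_m vs k.+1)%:R - (vtx_m vs k)%:R) / ((vtx_n vs k.+1)%:R - (vtx_n vs k)%:R)).

(* (n_(k+1) - n_k) / (m_k - m_(k+1)), for the same edge *)
Definition ratio (vs : seq (nat * nat)) (k : nat) : K :=
  ((vtx_n vs k.+1)%:R - (vtx_n vs k)%:R) / ((vtx_m vs k)%:R - (vtx_m vs k.+1)%:R).

(* The possible choices of gamma, d and R |-> U_R; several constructors may
   apply. The exponent l_2 is infinite in cases 1 and 2 and is not used there.
   In case 4 the index k is shifted: the chosen vertex has index k.+1. *)
Inductive associated (vs : seq (nat * nat)) (delta : nat) :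
    nat -> nat -> (K -> set (K[i] * K[i])) -> Prop :=
| Case1 :
    size vs = 1%N ->
    associated vs delta (vtx_n vs 0) (vtx_m vs 0)
      (fun R => [set x | R < cmod x.1 /\ R < cmod x.2])
| Case2 (l1 := ratio vs 0) :
    (1 < size vs)%N ->
    delta%:R <= intercept vs 0 ->
    associated vs delta (vtx_n vs 0) (vtx_m vs 0)
      (fun R => [set x | R < cmod x.1 /\ R * cmod x.1 `^ l1 < cmod x.2])
| Case3 (k : nat) (l2 := ratio vs k) :
    size vs = k.+2 ->
    intercept vs k <= delta%:R ->
    associated vs delta (vtx_n vs k.+1) (vtx_m vs k.+1)
      (fun R => [set x | R < cmod x.2 /\
                         cmod x.2 < R `^ (- l2) * cmod x.1 `^ l2])
| Case4 (k : nat) (l1 := ratio vs k.+1) (l2 := ratio vs k - l1) :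
    (k.+2 < size vs)%N ->
    intercept vs k <= delta%:R ->
    delta%:R <= intercept vs k.+1 ->
    associated vs delta (vtx_n vs k.+1) (vtx_m vs k.+1)
      (fun R => [set x | R * cmod x.1 `^ l1 < cmod x.2 /\
                         cmod x.2 < R `^ (- l2) * cmod x.1 `^ (l1 + l2)]).

End NewtonPolygon.

(* Main.v *)
(** In the logarithmic coordinates [x = ln |z|], [y = ln |w|], [r = ln R], every
    region [U_R] is a cone [phi_k (x, y) > e_k r] ([k = 1, 2]) for two linear
    forms [phi_1], [phi_2], and a linear form [k1 phi_1 + k2 phi_2] with
    [k1, k2 >= 0] is at least [(k1 e1 + k2 e2) r] there.

    The forms are normal to the edges of [N(q)] at [(gamma, d)], so convexity of
    [N(q)] says that, for every other monomial [z^i w^j] of [q],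
    [(gamma - i) x + (d - j) y] is such a combination with
    [k1 e1 + k2 e2 > 0]: the monomial is smaller than [z^gamma w^d] by a
    positive power of [R].

    The map [f_0] acts, up to bounded errors, by
    [(x, y) |-> (delta x, gamma x + d y)]. The position of [delta] relative to
    the intercepts [T_k] makes each [phi_k (delta x, gamma x + d y)] a
    nonnegative combination with [k1 e1 + k2 e2 > e_k], and the surplus
    multiple of [r] absorbs the bounded errors. *)

Require Import Defs.
From mathcomp Require Import all_boot all_order all_algebra.
From mathcomp Require Import all_classical all_reals all_analysis.
From mathcomp Require Import polyXY.
From mathcomp Require Import ring lra.

Set Implicit Arguments.
Unset Strict Implicit.
Unset Printing Implicit Defensive.

Import Order.TTheory GRing.Theory Num.Theory.

Local Open Scope classical_set_scope.
Local Open Scope ring_scope.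

(** * The Newton polygon: support, extreme points and lexicographic maxima *)

Section Newton.
Variable K : realType.
Implicit Types (q : {poly {poly K[i]}}) (u v : nat * nat) (vs : seq (nat * nat)).

Definition supp q : seq (nat * nat) :=
  [seq u <- [seq (i, j) | i <- iota 0 (size q), j <- iota 0 (size q`_i)]
     | q`_u.1`_u.2 != 0].

Lemma mem_supp q u : (u \in supp q) = (q`_u.1`_u.2 != 0).
Proof.
rewrite mem_filter; case: eqVneq => //= nz.
apply/allpairsPdep; exists u.1, u.2; rewrite !mem_iota /= !add0n.
split; last by case: u {nz}.
- by case: ltnP => // /(nth_default 0) z; rewrite z coef0 eqxx in nz.
- by case: ltnP => // /(nth_default 0) z; rewrite z eqxx in nz.
Qed.

Lemma uniq_supp q : uniq (supp q).
Proof.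
apply/filter_uniq/allpairs_uniq_dep; first exact: iota_uniq.
  by move=> i _; exact: iota_uniq.
by move=> [i j] [i' j'] _ _ [-> ->].
Qed.

Definition pt u : plane K := (u.1%:R, u.2%:R).

Lemma pt_inj : injective pt.
Proof.
move=> [i j] [i' j'] [/eqP + /eqP].
by rewrite !eqr_nat => /eqP -> /eqP ->.
Qed.

Lemma conv_planeE (x y : convex_lmodType (plane K)) (t : {i01 K}) :
  conv t x y = ((t%:num * x.1 + (1 - t%:num) * y.1,
                 t%:num * x.2 + (1 - t%:num) * y.2) : plane K).
Proof. by []. Qed.

Lemma supp_polygon q u (x : plane K) : u \in supp q ->
  x.1 <= u.1%:R -> x.2 <= u.2%:R -> newton_polygon q x.
Proof.
move=> uq x1 x2; apply: sub_gen_smallest.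
by exists u.1, u.2; rewrite -mem_supp.
Qed.

Definition lin (a b : K) (x : K * K) : K := a * x.1 + b * x.2.

(* Lexicographic maximisers are automatically extreme, which avoids having to
   perturb a linear form that is constant along an edge. *)
Definition lexle (a b a' b' : K) (x y : K * K) : Prop :=
  lin a b x < lin a b y \/
  (lin a b x = lin a b y /\ lin a' b' x <= lin a' b' y).

(** The points lexicographically below [y] form a convex set. With nonnegative coefficients a
    quadrant lies in it as soon as its corner does, so minimality of the hull applies. *)
Lemma polygon_lexle q a b a' b' (y : plane K) :
    0 <= a -> 0 <= b -> 0 <= a' -> 0 <= b' ->
    (forall u, u \in supp q -> lexle a b a' b' (pt u) y) ->
  newton_polygon q `<=` [set x | lexle a b a' b' x y].
Proof.
move=> a0 b0 a'0 b'0 qy; apply: smallest_sub.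
  apply/convex_setW => x x'; rewrite !inE => /= hx hx' t t0 t1.
  rewrite inE conv_planeE /=; move: hx hx'; rewrite /lexle /lin /=.
  set s := t%:num in t0 t1 *; case=> [h1|[h1 h2]] [k1|[k1 k2]].
  - by left; nra.
  - by left; nra.
  - by left; nra.
  - by right; split; nra.
move=> x [i [j [nz [/= xi xj]]]]; have := qy (i, j); rewrite mem_supp => /(_ nz).
rewrite /lexle /lin /= => h.
have h1 : a * x.1 + b * x.2 <= a * i%:R + b * j%:R by nra.
have h2 : a' * x.1 + b' * x.2 <= a' * i%:R + b' * j%:R by nra.
case: h => [h|[h h']]; first by left; lra.
by case: (ltgtP (a * x.1 + b * x.2) (a * i%:R + b * j%:R)) => g;
  [left; lra | lra | right; split; lra].
Qed.

(** If [pt v] is interior to a segment of the polygon, both endpoints must attain the maximum of the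
    first form, then that of the second. The determinant being nonzero, the two values single out
    [pt v]. *)
Lemma lexmax_vertex q a b a' b' v :
    0 <= a -> 0 <= b -> 0 <= a' -> 0 <= b' -> a * b' - a' * b != 0 ->
    v \in supp q ->
    (forall u, u \in supp q -> lexle a b a' b' (pt u) (pt v)) ->
  vertex (newton_polygon q) (pt v).
Proof.
move=> a0 b0 a'0 b'0 det vq vmax; split; first exact: supp_polygon vq _ _.
have sub := polygon_lexle a0 b0 a'0 b'0 vmax.
move=> x y t /sub /= hx /sub /= hy /andP[t0 t1] e.
suff inj z : lin a b z = lin a b (pt v) -> lin a' b' z = lin a' b' (pt v) ->
    z = pt v.
  have {e} [e1 e2] : t%:num * x.1 + (1 - t%:num) * y.1 = v.1%:R /\
                     t%:num * x.2 + (1 - t%:num) * y.2 = v.2%:R.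
    by move: e; rewrite conv_planeE => -[].
  set s := t%:num in t0 t1 e1 e2.
  have f1 : s * lin a b x + (1 - s) * lin a b y = lin a b (pt v).
    by rewrite /lin /= -e1 -e2; ring.
  have f2 : s * lin a' b' x + (1 - s) * lin a' b' y = lin a' b' (pt v).
    by rewrite /lin /= -e1 -e2; ring.
  move: hx hy inj f1 f2; rewrite /lexle.
  move: (lin a b (pt v)) (lin a' b' (pt v)) => A A' hx hy inj f1 f2.
  have [hx1 hy1] : lin a b x = A /\ lin a b y = A.
    by split; case: hx => [h|[h h']]; case: hy => [g|[g g']]; nra.
  rewrite hx1 hy1 !ltxx in hx hy.
  case: hx hy => [//|[_ hx]] [//|[_ hy]].
  by split; apply: inj => //; nra.
rewrite /lin /= => h1 h2; case: z h1 h2 => z1 z2 /= h1 h2.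
(* Cramer's rule for the coordinates of [z - pt v]. *)
have e1 : (a * b' - a' * b) * (z1 - v.1%:R) = 0.
  transitivity (b' * (a * z1 + b * z2 - (a * v.1%:R + b * v.2%:R)) -
    b * (a' * z1 + b' * z2 - (a' * v.1%:R + b' * v.2%:R))); first by ring.
  by rewrite h1 h2 !subrr !mulr0 subr0.
have e2 : (a * b' - a' * b) * (z2 - v.2%:R) = 0.
  transitivity (a * (a' * z1 + b' * z2 - (a' * v.1%:R + b' * v.2%:R)) -
    a' * (a * z1 + b * z2 - (a * v.1%:R + b * v.2%:R))); first by ring.
  by rewrite h1 h2 !subrr !mulr0 subr0.
move/eqP: e1; move/eqP: e2; rewrite !mulf_eq0 (negPf det) /= !subr_eq0.
by move=> /eqP -> /eqP ->.
Qed.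

Lemma seq_argmax (T : eqType) (f : T -> K) (s : seq T) :
  s != [::] -> exists2 m, m \in s & forall x, x \in s -> f x <= f m.
Proof.
elim: s => // x [|y s] IH _.
  by exists x => [|u]; rewrite inE // => /eqP ->.
have [m ms mmax] := IH isT; case: (leP (f x) (f m)) => xm.
  exists m; first by rewrite inE ms orbT.
  by move=> u; rewrite inE => /orP[/eqP ->|/mmax].
exists x; first by rewrite inE eqxx.
by move=> u; rewrite inE => /orP[/eqP ->|/mmax /le_trans]//; apply; exact: ltW.
Qed.

(** Maximise the first form over the finite support, then the second among the maximisers. *)
Lemma lexmax_exists q a b a' b' : q != 0 ->
  exists2 v, v \in supp q &
    forall u, u \in supp q -> lexle a b a' b' (pt u) (pt v).
Proof.
move=> q0; have sq0 : supp q != [::].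
  have : ((size q).-1, (size (lead_coef q)).-1) \in supp q.
    by rewrite mem_supp /= -lead_coefE -/(lead_coef _) !lead_coef_eq0.
  by case: (supp q).
have [m ms mmax] := @seq_argmax _ (fun u => lin a b (pt u)) _ sq0.
pose s := [seq u <- supp q | lin a b (pt u) == lin a b (pt m)].
have ms' : m \in s by rewrite mem_filter eqxx.
have s0 : s != [::] by case: s ms'.
have [v + vmax] := @seq_argmax _ (fun u => lin a' b' (pt u)) _ s0.
rewrite mem_filter => /andP[/eqP vm vq]; exists v => // u uq.
have := mmax u uq; rewrite le_eqVlt => /orP[/eqP e|]; last by rewrite -vm; left.
by right; rewrite vm; split=> //; apply: vmax; rewrite mem_filter e eqxx.
Qed.

(** Removing an extreme point from a convex set leaves it convex, so by minimality of the hull a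
    vertex lies in some generating quadrant; there extremality forces it to be the corner. *)
Lemma vertex_supp q (x : plane K) : vertex (newton_polygon q) x ->
  exists2 u, u \in supp q & x = pt u.
Proof.
move=> [xN xext].
have [i [j [nz [/= xi xj]]]] :
    [set x | exists i j, q`_i`_j != 0 /\ quadrant i j x] x.
  apply: contrapT => xA.
  suff : newton_polygon q `<=` [set y | newton_polygon q y /\ y <> x].
    by move=> /(_ x xN)[].
  apply: smallest_sub; last first.
    move=> y yA; split; first exact: sub_gen_smallest.
    by move=> yx; rewrite yx in yA.
  apply/convex_setW => y z; rewrite !inE => -[yN yx] [zN zx] t t0 t1.
  rewrite inE; split.
    move=> M [cM AM]; have := cM y z t; rewrite !inE; apply.
      exact: (yN M).
    exact: (zN M).
  by move=> e; have [] := xext y z t yN zN _ e; rewrite ?t0 ?t1.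
have uq : (i, j) \in supp q by rewrite mem_supp.
exists (i, j) => //.
(* [x] is the midpoint of the corner [(i, j)] and its reflection through [x]. *)
have h0 : (0 : K) <= 2^-1 by lra.
have h1 : (2^-1 : K) <= 1 by lra.
pose t : {i01 K} := Itv01 h0 h1.
pose y : plane K := (2 * x.1 - i%:R, 2 * x.2 - j%:R).
have [] // := xext (pt (i, j)) y t.
- exact: supp_polygon uq _ _.
- apply: supp_polygon uq _ _ => /=; lra.
- by rewrite /=; apply/andP; split; lra.
rewrite conv_planeE /=; case: x {xN xext xi xj} @y => x1 x2 /=.
by congr (_, _); field.
Qed.

(** If [B] were on or below the chord [AC], lowering the chord vertically until it meets [B] would
    keep its ends in the polygon, and [B] would be interior to a segment. *)
Lemma vertex_above_chord q (A B C : nat * nat) :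
    A \in supp q -> C \in supp q -> vertex (newton_polygon q) (pt B) ->
    (A.1 < B.1 < C.1)%N -> (C.2 < B.2 < A.2)%N ->
  (C.1%:R - B.1%:R) * (A.2%:R - B.2%:R)
    < (B.1%:R - A.1%:R) * (B.2%:R - C.2%:R) :> K.
Proof.
move=> Aq Cq [_ Bext] /andP[AB1 BC1] /andP[CB2 BA2]; rewrite ltNge.
move: AB1 BC1 CB2 BA2; rewrite -!(ltr_nat K).
move: A B C Aq Cq Bext => [a1 a2] [b1 b2] [c1 c2] Aq Cq Bext /= AB1 BC1 CB2 BA2.
apply/negP => h.
have d0 : 0 < c1%:R - a1%:R :> K by lra.
pose s : K := (c1%:R - b1%:R) / (c1%:R - a1%:R).
have sE : s * (c1%:R - a1%:R) = c1%:R - b1%:R by rewrite /s divfK ?gt_eqF.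
have s0 : 0 < s by rewrite divr_gt0 //; lra.
have s1 : s < 1 by rewrite ltr_pdivrMr //; lra.
(* The weight [s] gives the point of the chord with the abscissa of [B]; [e] is its height above
   [B]. *)
pose e : K := s * a2%:R + (1 - s) * c2%:R - b2%:R.
have e0 : 0 <= e.
  suff : 0 <= (c1%:R - a1%:R) * e by rewrite pmulr_rge0.
  suff -> : (c1%:R - a1%:R) * e = (c1%:R - b1%:R) * (a2%:R - b2%:R)
     - (b1%:R - a1%:R) * (b2%:R - c2%:R) by rewrite subr_ge0.
  transitivity (s * (c1%:R - a1%:R) * (a2%:R - c2%:R)
     + (c1%:R - a1%:R) * (c2%:R - b2%:R)); first by rewrite /e; ring.
  by rewrite sE; ring.
pose t : {i01 K} := Itv01 (ltW s0) (ltW s1).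
have [] := Bext (a1%:R, a2%:R - e) (c1%:R, c2%:R - e) t.
- apply: supp_polygon Aq _ _ => /=; lra.
- apply: supp_polygon Cq _ _ => /=; lra.
- by rewrite /= s0 s1.
- rewrite conv_planeE /pt /= /e; congr (_, _); last by ring.
  by transitivity (c1%:R - s * (c1%:R - a1%:R)); [ring|rewrite sE; ring].
by move=> [ab _] _; move: AB1; rewrite ab ltxx.
Qed.

(** * The ordered list of vertices: slopes, intercepts and supporting lines *)

Section Vertices.
Variables (q : {poly {poly K[i]}}) (vs : seq (nat * nat)).
Hypothesis vs_q : newton_vertices q vs.

Lemma vertex_vs v : v \in vs -> vertex (newton_polygon q) (pt v).
Proof. by move=> vvs; apply/(proj2 vs_q); exists v. Qed.

Lemma vs_supp v : v \in vs -> v \in supp q.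
Proof. by move=> /vertex_vs /vertex_supp[u uq /pt_inj ->]. Qed.

Lemma vs_ltn k l : (k < l)%N -> (l < size vs)%N ->
  (vtx_n vs k < vtx_n vs l)%N /\ (vtx_m vs l < vtx_m vs k)%N.
Proof.
move=> kl lv; apply/andP; rewrite /vtx_n /vtx_m.
apply: (sorted_ltn_nth _ _ (proj1 vs_q)) => //; last first.
  by rewrite inE (ltn_trans kl).
by move=> u v w /andP[a b] /andP[c d]; rewrite (ltn_trans a c) (ltn_trans d b).
Qed.

Lemma vtx_supp k : (k < size vs)%N -> (vtx_n vs k, vtx_m vs k) \in supp q.
Proof. by move=> kv; rewrite -surjective_pairing; apply/vs_supp/mem_nth. Qed.

Lemma vs_above_chord j k l : (j < k)%N -> (k < l)%N -> (l < size vs)%N ->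
  ((vtx_n vs l)%:R - (vtx_n vs k)%:R) * ((vtx_m vs j)%:R - (vtx_m vs k)%:R)
  < ((vtx_n vs k)%:R - (vtx_n vs j)%:R)
      * ((vtx_m vs k)%:R - (vtx_m vs l)%:R) :> K.
Proof.
move=> jk kl lv; have kv := ltn_trans kl lv.
have [n1 m1] := vs_ltn jk kv; have [n2 m2] := vs_ltn kl lv.
apply: (@vertex_above_chord q (nth (0, 0)%N vs j) (nth (0, 0)%N vs k)
  (nth (0, 0)%N vs l)).
- exact/vs_supp/mem_nth/(ltn_trans jk).
- exact/vs_supp/mem_nth.
- exact/vertex_vs/mem_nth.
- exact/andP.
- exact/andP.
Qed.

Lemma vs_lexmax a b a' b' : q != 0 ->
    0 <= a -> 0 <= b -> 0 <= a' -> 0 <= b' -> a * b' - a' * b != 0 ->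
  exists2 l, (l < size vs)%N & forall u, u \in supp q ->
    lexle a b a' b' (pt u) ((vtx_n vs l)%:R, (vtx_m vs l)%:R).
Proof.
move=> q0 a0 b0 a'0 b'0 det.
have [v vq vmax] := @lexmax_exists q a b a' b' q0.
have /(proj2 vs_q)[w wvs /pt_inj vw] := lexmax_vertex a0 b0 a'0 b'0 det vq vmax.
rewrite -{w}vw in wvs.
exists (index v vs); first by rewrite index_mem.
by rewrite /vtx_n /vtx_m nth_index.
Qed.

Lemma ratio_gt0 k : (k.+1 < size vs)%N -> 0 < Defs.ratio K vs k.
Proof.
move=> kv; have [n m] := vs_ltn (ltnSn k) kv.
by rewrite divr_gt0 // subr_gt0 ltr_nat.
Qed.

Lemma ratio_edge k : (k.+1 < size vs)%N ->
  Defs.ratio K vs k * ((vtx_m vs k)%:R - (vtx_m vs k.+1)%:R)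
  = (vtx_n vs k.+1)%:R - (vtx_n vs k)%:R.
Proof.
move=> kv; have [_] := vs_ltn (ltnSn k) kv; rewrite -(ltr_nat K) => m.
by rewrite /Defs.ratio divfK // subr_eq0 gt_eqF.
Qed.

(** The form [x + ratio * y] is constant along the line of the edge, and that line passes through
    [(0, intercept)]. This turns comparisons of [delta] with the intercepts into inequalities on
    exponents. *)
Lemma ratio_intercept k : (k.+1 < size vs)%N ->
  Defs.ratio K vs k * intercept K vs k
  = (vtx_n vs k)%:R + Defs.ratio K vs k * (vtx_m vs k)%:R.
Proof.
move=> kv; have [] := vs_ltn (ltnSn k) kv; rewrite -!(ltr_nat K) => n m.
rewrite /Defs.ratio /intercept; field.
by apply/andP; split; rewrite subr_eq0 ?(gt_eqF n) ?(gt_eqF m).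
Qed.

(** The chord inequality for three consecutive vertices, divided by the two height differences. *)
Lemma ratio_decr k : (k.+2 < size vs)%N -> Defs.ratio K vs k.+1 < Defs.ratio K vs k.
Proof.
move=> kv; have := vs_above_chord (ltnSn k) (ltnSn k.+1) kv.
have [_] := vs_ltn (ltnSn k) (ltnW kv); have [_] := vs_ltn (ltnSn k.+1) kv.
rewrite -!(ltr_nat K) => m m' h.
by rewrite /Defs.ratio ltr_pdivrMr ?subr_gt0 // mulrAC ltr_pdivlMr ?subr_gt0.
Qed.

(** The line through an edge supports the polygon: its linear form is maximised at some vertex, and
    no vertex lies strictly beyond the edge. *)
Lemma supp_edge k u : (k.+1 < size vs)%N -> u \in supp q ->
  u.1%:R + Defs.ratio K vs k * u.2%:R
  <= (vtx_n vs k)%:R + Defs.ratio K vs k * (vtx_m vs k)%:R.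
Proof.
move=> kv uq; have r0 := ratio_gt0 kv; have rE := ratio_edge kv.
have q0 : q != 0 by apply: contraTneq uq => ->; rewrite mem_supp !coef0 eqxx.
(* The form of the edge comes first, and ties are broken by height; the determinant is 1. *)
have [|l lv /(_ u uq) h] := vs_lexmax q0 ler01 (ltW r0) (lexx 0) ler01.
  by rewrite mul1r mul0r subr0 oner_eq0.
have {h} h : u.1%:R + Defs.ratio K vs k * u.2%:R
    <= (vtx_n vs l)%:R + Defs.ratio K vs k * (vtx_m vs l)%:R.
  by case: h => [/ltW|[]]; rewrite /lin /= !mul1r // => ->.
apply: (le_trans h); have [_] := vs_ltn (ltnSn k) kv; rewrite -(ltr_nat K) => m.
rewrite -(ler_pM2r (_ : 0 < (vtx_m vs k)%:R - (vtx_m vs k.+1)%:R)) ?subr_gt0 //.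
(* A vertex of the polygon strictly beyond the edge would put an endpoint of
   the edge on or below the chord from that vertex to the other endpoint. *)
case: (ltngtP l k) => [lk|kl|->] //.
  have := vs_above_chord lk (ltnSn k) kv; nra.
case: (ltngtP l k.+1) => [|kl'|->]; first by rewrite ltnS leqNgt kl.
  have := vs_above_chord (ltnSn k) kl' lv; nra.
nra.
Qed.

Lemma supp_first u : u \in supp q -> (u.2 <= vtx_m vs 0)%N.
Proof.
move=> uq.
have q0 : q != 0 by apply: contraTneq uq => ->; rewrite mem_supp !coef0 eqxx.
have [|l lv /(_ u uq) h] := vs_lexmax q0 (lexx 0) ler01 ler01 (lexx 0).
  by rewrite mul0r mul1r sub0r oppr_eq0 oner_eq0.
have {h} h : (u.2 <= vtx_m vs l)%N.
  by rewrite -(ler_nat K); case: h => [/ltW|[]];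
    rewrite /lin /= !mul0r !mul1r !add0r // => ->.
by case: l lv h => // l lv /leq_trans -> //; have [_ /ltnW] := vs_ltn (ltn0Sn l) lv.
Qed.

Lemma supp_last u k : size vs = k.+1 -> u \in supp q -> (u.1 <= vtx_n vs k)%N.
Proof.
move=> sz uq.
have q0 : q != 0 by apply: contraTneq uq => ->; rewrite mem_supp !coef0 eqxx.
have [|l lv /(_ u uq) h] := vs_lexmax q0 ler01 (lexx 0) (lexx 0) ler01.
  by rewrite mul0r mul1r subr0 oner_eq0.
have {h} h : (u.1 <= vtx_n vs l)%N.
  by rewrite -(ler_nat K); case: h => [/ltW|[]];
    rewrite /lin /= !mul0r !mul1r !addr0 // => ->.
apply: (leq_trans h); move: lv; rewrite sz ltnS leq_eqVlt => /predU1P[->//|lk].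
by have [/ltnW] := vs_ltn lk (eq_leq (esym sz)).
Qed.

End Vertices.
End Newton.

(** * The modulus on [K[i]] and its logarithm *)

Section Cmod.
Variable K : realType.
Implicit Types z w : K[i].

Lemma cmod_ge0 z : 0 <= cmod z.
Proof. by case: z => a b; exact: sqrtr_ge0. Qed.

Lemma cmodM z w : cmod (z * w) = cmod z * cmod w.
Proof. exact: ComplexField.Normc.normcM. Qed.

Lemma cmodX z n : cmod (z ^+ n) = cmod z ^+ n.
Proof.
elim: n => [|n IH]; first by rewrite !expr0 [LHS]ComplexField.Normc.normc1.
by rewrite !exprS cmodM IH.
Qed.

Lemma cmod0 : cmod (0 : K[i]) = 0.
Proof. exact: ComplexField.Normc.normc0. Qed.

Lemma cmod_eq0 z : (cmod z == 0) = (z == 0).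
Proof.
apply/eqP/eqP => [/ComplexField.Normc.eq0_normc //|->]; exact: cmod0.
Qed.

Lemma cmod_gt0 z : (0 < cmod z) = (z != 0).
Proof. by rewrite lt0r cmod_ge0 andbT cmod_eq0. Qed.

Lemma ler_cmodD z w : cmod (z + w) <= cmod z + cmod w.
Proof. exact: le_normcD. Qed.

Lemma cmodN z : cmod (- z) = cmod z.
Proof. exact: normcN. Qed.

(** A relative error below one half keeps the quotient of the moduli between 1/2 and 3/2, hence
    within a factor 2 of 1. *)
Lemma ln_cmod_near z w : w != 0 -> cmod (z - w) < 2^-1 * cmod w ->
  z != 0 /\ `|ln (cmod z) - ln (cmod w)| <= ln 2.
Proof.
rewrite -!cmod_gt0 => w0 zw.
have h1 : cmod z <= cmod (z - w) + cmod w.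
  by have := ler_cmodD (z - w) w; rewrite subrK.
have h2 : cmod w <= cmod (z - w) + cmod z.
  by have := ler_cmodD (w - z) z; rewrite subrK -[w - z]opprB cmodN.
have z0 : 0 < cmod z by lra.
split=> //; rewrite ler_norml; apply/andP; split.
  rewrite -subr_ge0 opprK addrAC subr_ge0 -lnM ?posrE // ler_ln ?posrE //; first lra.
  by rewrite mulr_gt0.
by rewrite lerBlDr -lnM ?posrE // ler_ln ?posrE // ?mulr_gt0 //; lra.
Qed.

End Cmod.

(** * Cones in logarithmic coordinates: dominant monomials and invariance *)

Section Cone.
Variable K : realType.

Lemma near_ln_gt (M : K) : \forall R \near +oo, M < ln R.
Proof.
near=> R; have h : expR M < R.
  by near: R; apply: nbhs_pinfty_gt; exact: num_real.
by rewrite -[M]expRK ltr_ln // posrE ?expR_gt0 // (lt_trans _ h) // expR_gt0.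
Unshelve. all: by end_near. Qed.

Lemma expR_lnX (x : K) n : 0 < x -> x ^+ n = expR (n%:R * ln x).
Proof. by move=> x0; rewrite expRM_natl lnK. Qed.

Variables s1 t1 e1 s2 t2 e2 : K.

Definition cone (r x y : K) : Prop :=
  e1 * r < s1 * x + t1 * y /\ e2 * r < s2 * x + t2 * y.

(** A Farkas-type certificate that [a x + b y] grows in [r] on the cone at a rate strictly above
    [e]. *)
Definition conic (a b e : K) : Prop :=
  exists k1 k2 : K, [/\ 0 <= k1, 0 <= k2, e < k1 * e1 + k2 * e2,
    a = k1 * s1 + k2 * s2 & b = k1 * t1 + k2 * t2].

Lemma conic_grow a b e : conic a b e ->
  exists2 c, e < c & forall r x y, cone r x y -> c * r <= a * x + b * y.
Proof.
move=> [k1 [k2 [k10 k20 e12 -> ->]]]; exists (k1 * e1 + k2 * e2) => //.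
move=> r x y [h1 h2].
have g1 : k1 * (e1 * r) <= k1 * (s1 * x + t1 * y) by rewrite ler_wpM2l // ltW.
have g2 : k2 * (e2 * r) <= k2 * (s2 * x + t2 * y) by rewrite ler_wpM2l // ltW.
lra.
Qed.

Variable U : K -> set (K[i] * K[i]).
Hypothesis U_cone : forall R, 1 < R -> forall z w, U R (z, w) <->
  [/\ z != 0, w != 0 & cone (ln R) (ln (cmod z)) (ln (cmod w))].

(** In logarithms the bound reads [- ln eps <= (g - i) x + (d - j) y], and the right side is at
    least [c * ln R] with [c > 0]. *)
Lemma monomial_small (g d i j : nat) (eps : K) : 0 < eps ->
    conic (g%:R - i%:R) (d%:R - j%:R) 0 ->
  \forall R \near +oo, forall z w, U R (z, w) ->
    cmod (z ^+ i * w ^+ j) <= eps * cmod (z ^+ g * w ^+ d).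
Proof.
move=> eps0 /conic_grow[c c0 grow]; near=> R => z w.
have R1 : 1 < R by near: R; apply: nbhs_pinfty_gt; exact: num_real.
move=> /(U_cone R1)[z0 w0] /grow.
rewrite !cmodM !cmodX !expR_lnX ?cmod_gt0 //.
move: (ln (cmod z)) (ln (cmod w)) => x y h.
have hR : - ln eps / c < ln R by near: R; exact: near_ln_gt.
rewrite ltr_pdivrMr // in hR.
by rewrite -[eps]lnK ?posrE // -!expRD ler_expR; lra.
Unshelve. all: by end_near. Qed.

Lemma polynomial_small (g d : nat) (s : seq (nat * nat)) (b : nat * nat -> K[i]) :
    (forall u : nat * nat, u \in s -> conic (g%:R - u.1%:R) (d%:R - u.2%:R) 0) ->
  forall eps, 0 < eps -> \forall R \near +oo, forall z w, U R (z, w) ->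
    cmod (\sum_(u <- s) b u * z ^+ u.1 * w ^+ u.2)
      <= eps * cmod (z ^+ g * w ^+ d).
Proof.
elim: s => [|u s IH] h eps eps0.
  apply: nearW => R z w _; rewrite big_nil cmod0 mulr_ge0 ?cmod_ge0 //; exact: ltW.
(* Head and tail each receive half of [eps]; the [+ 1] keeps the divisor positive when [b u]
   vanishes. *)
have b1 : 0 < cmod (b u) + 1 by rewrite ltr_wpDl ?cmod_ge0.
have eps1 : 0 < eps / 2 / (cmod (b u) + 1) by rewrite !divr_gt0.
have eps2 : 0 < eps / 2 by rewrite divr_gt0.
have hu := monomial_small eps1 (h u (mem_head u s)).
have hs := IH (fun v vs => h v (@mem_behead _ (u :: s) v vs)) _ eps2.
apply: filterS2 hu hs => R hu hs z w zw; rewrite big_cons.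
have {}hu := hu z w zw; have {}hs := hs z w zw.
apply: (le_trans (ler_cmodD _ _)).
rewrite [X in _ <= X * _](splitr eps) mulrDl lerD // -mulrA cmodM.
have := ler_wpM2l (cmod_ge0 (b u)) hu => /le_trans; apply.
rewrite mulrA ler_wpM2r ?cmod_ge0 // mulrCA ler_piMr ?(ltW eps2) //.
by rewrite ler_pdivrMr // mul1r lerDl.
Qed.

Variables (p : {poly K[i]}) (q : {poly {poly K[i]}}) (delta g d : nat).
Hypothesis size_p : size p = delta.+1.
Hypothesis gd_q : (g, d) \in supp q.
Hypothesis conic_z : conic 1 0 0.
Hypothesis conic_q : forall u : nat * nat, u \in supp q -> u != (g, d) ->
  conic (g%:R - u.1%:R) (d%:R - u.2%:R) 0.

Lemma horner_supp z w :
  q.[z, w] = \sum_(u <- supp q) q`_u.1`_u.2 * z ^+ u.1 * w ^+ u.2.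
Proof.
rewrite big_filter; transitivity
    (\sum_(u <- [seq (i, j) | i <- iota 0 (size q), j <- iota 0 (size q`_i)])
       q`_u.1`_u.2 * z ^+ u.1 * w ^+ u.2).
  rewrite big_allpairs_dep /= (horner_coef q) horner_sum -(big_mkord xpredT
    (fun i => (q`_i * z%:P ^+ i).[w])) /index_iota subn0.
  apply: eq_bigr => i _.
  rewrite -rmorphXn hornerM hornerC horner_coef mulr_suml.
  rewrite -(big_mkord xpredT (fun j => q`_i`_j * w ^+ j * z ^+ i)).
  by rewrite /index_iota subn0; apply: eq_bigr => j _; rewrite mulrAC.
rewrite [LHS](bigID (fun u : nat * nat => q`_u.1`_u.2 != 0)) /=.
rewrite [X in _ + X]big1 ?addr0 // => u /negPn/eqP ->.
by rewrite !mul0r.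
Qed.

Lemma p_lead_gt0 : 0 < cmod p`_delta.
Proof.
rewrite cmod_gt0 -[delta]/(delta.+1.-1) -size_p lead_coef_eq0.
by rewrite -size_poly_eq0 size_p.
Qed.

Lemma p_near eps : 0 < eps -> \forall R \near +oo, forall z w, U R (z, w) ->
  cmod (p.[z] - p0 p delta z) < eps * cmod (p0 p delta z).
Proof.
move=> eps0.
have a0 := p_lead_gt0.
(* Halving [eps] makes the final bound strict; the other factor accounts for the leading
   coefficient. *)
have e0 : 0 < eps / 2 * cmod p`_delta by rewrite mulr_gt0 ?divr_gt0.
(* The lower terms of [p] are treated as monomials [z^k w^0]; their certificate is that of [conic_z]
   scaled by [delta - k > 0]. *)
have small : forall u : nat * nat, u \in [seq (i, 0%N) | i <- iota 0 delta] ->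
    conic (delta%:R - u.1%:R) (0%:R - u.2%:R) 0.
  move=> u /mapP[k]; rewrite mem_iota /= add0n => kd ->.
  have [k1 [k2 [k10 k20 k12 e e']]] := conic_z.
  have kd0 : 0 < delta%:R - k%:R :> K by rewrite subr_gt0 ltr_nat.
  exists ((delta%:R - k%:R) * k1), ((delta%:R - k%:R) * k2).
  rewrite !mulr_ge0 ?(ltW kd0) //= -!mulrA -!mulrDr; split=> //.
  - by rewrite mulr_gt0.
  - by rewrite -e mulr1.
  - by rewrite -e' mulr0 subr0.
have := polynomial_small (fun u => p`_u.1) small e0.
apply: filterS2 (nbhs_pinfty_gt (num_real (1 : K))) => R R1 small' z w zw.
have [z0 _ _] := (U_cone R1 z w).1 zw.
have := small' z w zw.
rewrite big_map /p0 horner_coef size_p big_ord_recr /= addrK.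
rewrite mulr1 -mulrA -cmodM.
rewrite -(big_mkord xpredT (fun i => p`_i * z ^+ i)) /index_iota subn0.
under eq_bigr do rewrite mulr1.
move=> /le_lt_trans; apply.
rewrite ltr_pM2r ?ltr_pdivrMr ?ltr_pMr ?ltr1n //.
by rewrite cmod_gt0 mulf_neq0 ?expf_neq0 // -cmod_gt0.
Qed.

Lemma q_near eps : 0 < eps -> \forall R \near +oo, forall z w, U R (z, w) ->
  cmod (q.[z, w] - q0 q g d z w) < eps * cmod (q0 q g d z w).
Proof.
move=> eps0.
have a0 : 0 < cmod q`_g`_d by rewrite cmod_gt0; move: gd_q; rewrite mem_supp.
have e0 : 0 < eps / 2 * cmod q`_g`_d by rewrite mulr_gt0 ?divr_gt0.
have small : forall u : nat * nat, u \in [seq u <- supp q | u != (g, d)] ->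
    conic (g%:R - u.1%:R) (d%:R - u.2%:R) 0.
  by move=> u; rewrite mem_filter => /andP[? ?]; exact: conic_q.
have := polynomial_small (fun u => q`_u.1`_u.2) small e0.
apply: filterS2 (nbhs_pinfty_gt (num_real (1 : K))) => R R1 small' z w zw.
have [z0 w0 _] := (U_cone R1 z w).1 zw.
have := small' z w zw.
rewrite big_filter horner_supp (bigD1_seq (g, d)) ?uniq_supp //= /q0 addrAC.
rewrite subrr add0r -mulrA -cmodM mulrA => /le_lt_trans; apply.
rewrite ltr_pM2r ?ltr_pdivrMr ?ltr_pMr ?ltr1n //.
by rewrite cmod_gt0 !mulf_neq0 ?expf_neq0 // -cmod_gt0.
Qed.

Hypothesis conic_inv1 :
  conic (s1 * delta%:R + t1 * g%:R) (t1 * d%:R) e1.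
Hypothesis conic_inv2 :
  conic (s2 * delta%:R + t2 * g%:R) (t2 * d%:R) e2.

Lemma cone_invariant : \forall R \near +oo, skew_product p q @` U R `<=` U R.
Proof.
have half0 : 0 < 2^-1 :> K by rewrite invr_gt0.
have pn := p_near half0; have qn := q_near half0.
have [c1 ec1 grow1] := conic_grow conic_inv1.
have [c2 ec2 grow2] := conic_grow conic_inv2.
have a0 := p_lead_gt0.
have b0 : 0 < cmod q`_g`_d by rewrite cmod_gt0; move: gd_q; rewrite mem_supp.
(* [A] and [B] bound the deviation of [(ln |p|, ln |q|)] from [(delta x, g x + d y)]: [ln 2] for the
   lower terms, the rest for the leading coefficient. *)
pose al := ln (cmod p`_delta); pose A := ln 2 + `|al|.
pose be := ln (cmod q`_g`_d); pose B := ln 2 + `|be|.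
near=> R.
have R1 : 1 < R by near: R; apply: nbhs_pinfty_gt; exact: num_real.
(* From here on the surplus [(c1 - e1) * ln R] exceeds the largest error that the first form can
   pick up; the same is then asked for the second. *)
have R1' : (`|s1| * A + `|t1| * B) / (c1 - e1) < ln R
  by near: R; exact: near_ln_gt.
have R2' : (`|s2| * A + `|t2| * B) / (c2 - e2) < ln R
  by near: R; exact: near_ln_gt.
rewrite !ltr_pdivrMr ?subr_gt0 // in R1' R2'.
have pR : forall z w, U R (z, w) ->
  cmod (p.[z] - p0 p delta z) < 2^-1 * cmod (p0 p delta z) by near: R.
have qR : forall z w, U R (z, w) ->
  cmod (q.[z, w] - q0 q g d z w) < 2^-1 * cmod (q0 q g d z w) by near: R.
move=> _ [[z w] zw <-]; apply/(U_cone R1) => /=.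
have {}pR := pR _ _ zw; have {}qR := qR _ _ zw.
have [z0 w0 zwc] := (U_cone R1 z w).1 zw.
have [|pz lp] := ln_cmod_near _ pR.
  by rewrite /p0 mulf_neq0 ?expf_neq0 // -cmod_gt0.
have [|qz lq] := ln_cmod_near _ qR.
  by rewrite /q0 !mulf_neq0 ?expf_neq0 // -cmod_gt0.
split=> //; rewrite -!cmod_gt0 in z0 w0.
move: lp lq; rewrite /p0 /q0 !cmodM !cmodX.
rewrite !lnM ?posrE ?mulr_gt0 ?exprn_gt0 // !lnXn // -![ln _ *+ _]mulr_natl -/al -/be.
move: (ln (cmod p.[z])) (ln (cmod q.[z, w])) => P Q.
have {grow1} := grow1 _ _ _ zwc; have {grow2} := grow2 _ _ _ zwc.
move: (ln (cmod z)) (ln (cmod w)) => x y g2 g1 lp lq.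
have hA : `|P - delta%:R * x| <= A.
  rewrite (_ : P - _ = (P - (al + delta%:R * x)) + al); last by ring.
  by apply: (le_trans (ler_normD _ _)); rewrite lerD2r.
have hB : `|Q - (g%:R * x + d%:R * y)| <= B.
  rewrite (_ : Q - _ = (Q - (be + g%:R * x + d%:R * y)) + be); last by ring.
  by apply: (le_trans (ler_normD _ _)); rewrite lerD2r.
have bound s t : - (`|s| * A + `|t| * B) <=
    s * (P - delta%:R * x) + t * (Q - (g%:R * x + d%:R * y)).
  rewrite lerNl; apply: (le_trans (ler_norm _)); rewrite normrN.
  apply: (le_trans (ler_normD _ _)).
  by rewrite !normrM lerD // ler_wpM2l.
split.
  by move: (bound s1 t1) R1' g1; lra.
by move: (bound s2 t2) R2' g2; lra.
Unshelve. all: by end_near. Qed.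

Lemma cone_conclusion :
  (forall eps : K, 0 < eps ->
     exists2 R : K, 0 < R &
       forall z w : K[i], U R (z, w) ->
         cmod (p.[z] - p0 p delta z) < eps * cmod (p0 p delta z) /\
         cmod (q.[z, w] - q0 q g d z w) < eps * cmod (q0 q g d z w)) /\
  (\forall R \near +oo, skew_product p q @` U R `<=` U R).
Proof.
split; last exact: cone_invariant.
move=> eps eps0; have pn := p_near eps0; have qn := q_near eps0.
have R0 : \forall R \near +oo, 0 < R :> K.
  by apply: nbhs_pinfty_gt; exact: num_real.
have [R [[{}pn {}qn] {}R0]] := filter_ex (filterI (filterI pn qn) R0).
by exists R => // z w zw; split; [exact: pn zw|exact: qn zw].
Qed.

End Cone.

(** * The regions [U_R] as cones, with explicit conic certificates *)

Section Regions.
Variable K : realType.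

Lemma powR_expR (a x : K) : 0 < a -> a `^ x = expR (x * ln a).
Proof. by move=> a0; rewrite /powR gt_eqF. Qed.

Lemma outer_region (R l1 m n : K) : 1 < R -> 0 <= m -> 0 <= n ->
  (R < m /\ R * m `^ l1 < n) <->
  [/\ 0 < m, 0 < n & cone (- l1) 1 1 1 0 1 (ln R) (ln m) (ln n)].
Proof.
move=> R1 m0 n0; have R0 : 0 < R by exact: lt_trans R1.
have E : 0 < m -> 0 < n -> (R < m /\ R * m `^ l1 < n) <->
    cone (- l1) 1 1 1 0 1 (ln R) (ln m) (ln n).
  move=> mp np; rewrite -[R in R * _]lnK ?posrE // powR_expR // -expRD.
  rewrite -[n]lnK ?posrE // ltr_expR expRK -ltr_ln ?posrE //.
  by rewrite /cone; split=> -[h1 h2]; split; lra.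
split=> [[h1 h2]|[mp np /(E mp np)//]].
have mp : 0 < m by exact: lt_trans h1.
have np : 0 < n by apply: le_lt_trans h2; rewrite mulr_ge0 ?powR_ge0 // ltW.
by split=> //; apply/E.
Qed.

Lemma inner_region (R l1 l m n : K) : l != 0 -> 1 < R -> 0 <= m -> 0 <= n ->
  (R * m `^ l1 < n /\ n < R `^ (- (l - l1)) * m `^ l) <->
  [/\ 0 < m, 0 < n & cone (- l1) 1 1 l (-1) (l - l1) (ln R) (ln m) (ln n)].
Proof.
move=> l0 R1 m0 n0; have R0 : 0 < R by exact: lt_trans R1.
have E : 0 < m -> 0 < n ->
    (R * m `^ l1 < n /\ n < R `^ (- (l - l1)) * m `^ l) <->
    cone (- l1) 1 1 l (-1) (l - l1) (ln R) (ln m) (ln n).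
  move=> mp np; rewrite -[R in R * _]lnK ?posrE // !powR_expR // -!expRD.
  rewrite -[n]lnK ?posrE // !ltr_expR expRK.
  by rewrite /cone; split=> -[h1 h2]; split; lra.
split=> [[h1 h2]|[mp np /(E mp np)//]].
have np : 0 < n by apply: le_lt_trans h1; rewrite mulr_ge0 ?powR_ge0 // ltW.
have mp : 0 < m.
  rewrite lt0r m0 andbT; apply/eqP => m00; move: h2.
  (* Since [l] is nonzero, a zero base has power zero, and the upper bound on [n] would be 0. *)
  by rewrite m00 powR0 // mulr0 ltNge n0.
by split=> //; apply/E.
Qed.

Variables (p : {poly K[i]}) (q : {poly {poly K[i]}}) (delta g d : nat).
Hypothesis size_p : size p = delta.+1.
Hypothesis gd_q : (g, d) \in supp q.
Variable U : K -> set (K[i] * K[i]).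

Let conclusion :=
  (forall eps : K, 0 < eps ->
     exists2 R : K, 0 < R &
       forall z w : K[i], U R (z, w) ->
         cmod (p.[z] - p0 p delta z) < eps * cmod (p0 p delta z) /\
         cmod (q.[z, w] - q0 q g d z w) < eps * cmod (q0 q g d z w)) /\
  (\forall R \near +oo, skew_product p q @` U R `<=` U R).

Lemma gd_neq (u : nat * nat) : u != (g, d) ->
  g%:R - u.1%:R != 0 :> K \/ d%:R - u.2%:R != 0 :> K.
Proof.
case: u => i j; rewrite xpair_eqE negb_and !subr_eq0 !eqr_nat ![_ == g]eq_sym.
by rewrite ![_ == d]eq_sym => /orP[]; [left|right].
Qed.

(** Here [phi_1 = y - l1 x] and [phi_2 = x], both with [e = 1]; [l1 = 0] gives the region of a
    single vertex. The last two hypotheses concern [D = g + l1 d - l1 delta]. *)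
Lemma outer_conclusion (l1 : K) :
    (forall R z w, U R (z, w) <-> R < cmod z /\ R * cmod z `^ l1 < cmod w) ->
    (forall u, u \in supp q -> (u.2 <= d)%N) ->
    (forall u, u \in supp q -> u.1%:R + l1 * u.2%:R <= g%:R + l1 * d%:R) ->
    (2 <= delta)%N -> l1 * delta%:R <= g%:R + l1 * d%:R ->
    1 < d%:R + (g%:R + l1 * d%:R - l1 * delta%:R) ->
  conclusion.
Proof.
move=> UE qd ql delta2 D0 D1; rewrite -(ler_nat K) in delta2.
apply: (@cone_conclusion _ (- l1) 1 1 1 0 1) => //.
- move=> R R1 z w; rewrite -!cmod_gt0; apply: (iff_trans (UE R z w)).
  by apply: outer_region; rewrite ?cmod_ge0.
- by exists 0, 1; split; rewrite ?ler01 //; lra.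
- move=> u uq ugd; have := qd u uq; rewrite -(ler_nat K) => hd.
  have hl := ql u uq.
  (* Expansion of [(g - i) x + (d - j) y] in [phi_1] and [phi_2]; both weights vanish only at
     [(g, d)]. *)
  exists (d%:R - u.2%:R), (g%:R - u.1%:R + l1 * (d%:R - u.2%:R)).
  split; try lra; rewrite ltNge; apply/negP => le0.
  have b0 : d%:R - u.2%:R = 0 :> K by lra.
  have a0 : g%:R - u.1%:R = 0 :> K by have := congr1 ( *%R l1) b0; lra.
  by have := gd_neq ugd; rewrite a0 b0 eqxx => -[].
(* Under [f_0], [phi_1] becomes [d phi_1 + D phi_2] and [phi_2] becomes [delta phi_2]. *)
- by exists d%:R, (g%:R + l1 * d%:R - l1 * delta%:R); split; rewrite ?ler0n; lra.
- by exists 0, delta%:R; split; rewrite ?ler0n; lra.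
Qed.

(** Here [phi_1 = y - l1 x] and [phi_2 = l x - y], with [e_1 = 1], [e_2 = l - l1] and [l = l1 + l2].
    As [phi_1 + phi_2 = (l - l1) x], a nonnegative multiple of [x] is split equally between the
    forms. *)
Lemma inner_conclusion (l1 l : K) :
    (forall R, 0 < R -> forall z w, U R (z, w) <->
       R * cmod z `^ l1 < cmod w /\
       cmod w < R `^ (- (l - l1)) * cmod z `^ l) ->
    0 <= l1 -> l1 < l -> (1 <= d)%N ->
    (forall u, u \in supp q -> u.1%:R + l1 * u.2%:R <= g%:R + l1 * d%:R) ->
    (forall u, u \in supp q -> u.1%:R + l * u.2%:R <= g%:R + l * d%:R) ->
    l1 * delta%:R <= g%:R + l1 * d%:R ->
    1 < d%:R + (g%:R + l1 * d%:R - l1 * delta%:R) ->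
    g%:R + l * d%:R <= l * delta%:R ->
    1 < d%:R + (l * delta%:R - (g%:R + l * d%:R)) ->
  conclusion.
Proof.
move=> UE l10 l1l d1 ql1 ql D0 D1 E0 E1; rewrite -(ler_nat K) in d1.
have l2 : 0 < l - l1 by rewrite subr_gt0.
have l2n : l - l1 != 0 by rewrite gt_eqF.
apply: (@cone_conclusion _ (- l1) 1 1 l (-1) (l - l1)) => //.
- move=> R R1 z w; rewrite -!cmod_gt0.
  apply: (iff_trans (UE R (lt_trans ltr01 R1) z w)).
  by apply: inner_region; rewrite ?cmod_ge0 // gt_eqF // (le_lt_trans l10).
- exists (l - l1)^-1, (l - l1)^-1; split.
  + by rewrite invr_ge0 ltW.
  + by rewrite invr_ge0 ltW.
  + by rewrite mulr1 mulVf // addr_gt0 ?invr_gt0.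
  + by field.
  + by ring.
- move=> u uq ugd; have h1 := ql1 u uq; have h := ql u uq.
  set a := g%:R - u.1%:R; set b := d%:R - u.2%:R.
  have ab1 : 0 <= a + l1 * b by rewrite /a /b; lra.
  have ab : 0 <= a + l * b by rewrite /a /b; lra.
  exists ((a + l * b) / (l - l1)), ((a + l1 * b) / (l - l1)); split.
  + by rewrite divr_ge0 // ltW.
  + by rewrite divr_ge0 // ltW.
  + rewrite mulr1 divfK // lt0r addr_ge0 ?divr_ge0 ?(ltW l2) // andbT.
    rewrite paddr_eq0 ?divr_ge0 ?(ltW l2) // mulf_eq0 invr_eq0 (negPf l2n) orbF.
    apply/negP => /andP[/eqP e /eqP e1].
    have b0 : b = 0.
      by apply: (mulfI l2n); rewrite mulr0; lra.
    have a0 : a = 0 by rewrite -e b0 mulr0 addr0.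
    by have := gd_neq ugd; rewrite -/a -/b a0 b0 eqxx => -[].
  + by field.
  + by field.
(* Under [f_0], [phi_1] becomes [d phi_1 + D x]. *)
- pose D : K := g%:R + l1 * d%:R - l1 * delta%:R.
  have D0' : 0 <= D by rewrite subr_ge0.
  have DK : D / (l - l1) * (l - l1) = D by exact: divfK.
  have D2 : 0 <= D / (l - l1) by rewrite divr_ge0 // ltW.
  exists (d%:R + D / (l - l1)), (D / (l - l1)); split=> //.
  + by rewrite addr_ge0.
  + by rewrite mulr1 DK; rewrite -/D in D1; lra.
  + by rewrite /D; field.
  + by ring.
(* Under [f_0], [phi_2] becomes [d phi_2 + E x]. *)
- pose E : K := l * delta%:R - (g%:R + l * d%:R).
  have E0' : 0 <= E by rewrite subr_ge0.
  have EK : E / (l - l1) * (l - l1) = E by exact: divfK.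
  have E2 : 0 <= E / (l - l1) by rewrite divr_ge0 // ltW.
  exists (E / (l - l1)), (d%:R + E / (l - l1)); split=> //.
  + by rewrite addr_ge0.
  + rewrite mulr1 [(d%:R + _) * _]mulrDl EK; rewrite -/E in E1.
    have : 0 <= (l - l1) * (d%:R - 1) by rewrite mulr_ge0 ?subr_ge0 // ltW.
    (* Either [E > 0] supplies the strict surplus, or [E = 0] and then [E1] forces [d > 1]. *)
    have [Ep|E00] := ltP 0 E; first by lra.
    have : 0 < (l - l1) * (d%:R - 1) by rewrite mulr_gt0 //; lra.
    lra.
  + by rewrite /E; field.
  + by rewrite /E; field.
Qed.

End Regions.

(** * The four cases: exponents and surpluses read off the polygon *)

Unset Implicit Arguments.

Theorem proposition1p1 (K : realType) (p : {poly K[i]})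
    (q : {poly {poly K[i]}}) (delta : nat) (vs : seq (nat * nat))
    (gamma d : nat) (U : K -> set (K[i] * K[i]))
    (deg_p : size p = delta.+1) (delta_ge2 : (2 <= delta)%N)
    (deg_q : (2 <= total_degree q)%N)
    (vs_q : newton_vertices q vs)
    (gdU : associated vs delta gamma d U)
    (hd : (2 <= d)%N \/
          d = 1%N /\ forall k : nat, (k.+1 < size vs)%N ->
                       delta%:R <> intercept K vs k) :
  (forall eps : K, 0 < eps ->
     exists2 R : K, 0 < R &
       forall z w : K[i], U R (z, w) ->
         cmod (p.[z] - p0 p delta z) < eps * cmod (p0 p delta z) /\
         cmod (q.[z, w] - q0 q gamma d z w) < eps * cmod (q0 q gamma d z w)) /\
  (\forall R \near +oo, skew_product p q @` U R `<=` U R).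
Proof.
have vq k : (k < size vs)%N -> _ := vtx_supp vs_q (k := k).
have ltv k l : (k < l)%N -> (l < size vs)%N -> _ := vs_ltn vs_q (k := k) (l := l).
have r0 k : (k.+1 < size vs)%N -> _ := ratio_gt0 vs_q (k := k).
have rT k : (k.+1 < size vs)%N -> _ := ratio_intercept vs_q (k := k).
have edge k u : (k.+1 < size vs)%N -> u \in supp q -> _ :=
  supp_edge vs_q (k := k) (u := u).
(* The form of an edge takes equal values at both ends; this serves when [(gamma, d)] is the
   right-hand end. *)
have prevE k : (k.+1 < size vs)%N -> (vtx_n vs k.+1)%:R
    + Defs.ratio K vs k * (vtx_m vs k.+1)%:R
    = (vtx_n vs k)%:R + Defs.ratio K vs k * (vtx_m vs k)%:R.
  by move=> /(ratio_edge vs_q); lra.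
case: gdU hd => {gamma d U}.
- move=> vs1 hd; have first := supp_first vs_q; have last := supp_last vs_q vs1.
  apply: (@outer_conclusion _ _ _ _ _ _ deg_p _ _ 0) => //.
  + by apply: vq; rewrite vs1.
  + by move=> R z w; rewrite /= powRr0 mulr1.
  + by move=> u uq; rewrite !mul0r !addr0 ler_nat last.
  + by rewrite !mul0r addr0 ler0n.
  rewrite !mul0r addr0 subr0 -natrD ltr1n.
  case: hd => [d2|[d1 _]]; first by rewrite ltn_addr.
  (* For [d = 1] the surplus is [gamma]: if it were 0, all exponents would satisfy [i <= 0] and
     [j <= 1], against total degree at least 2. *)
  rewrite d1 addnC addn1 ltnS lt0n; apply: contraTneq deg_q => n0.
  rewrite -ltnNge ltnS /total_degree; apply/bigmax_leqP => i _.
  apply/bigmax_leqP => j nz; have ijq : (i : nat, j : nat) \in supp q.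
    by rewrite mem_supp.
  by rewrite -d1 -[vtx_m vs 0]add0n -{1}n0 leq_add ?(last _ ijq) ?(first _ ijq).
- move=> l1 sz T1 hd; have first := supp_first vs_q.
  have TE := rT 0 sz; have l10 : 0 < l1 := r0 0 sz.
  (* By [ratio_intercept] this product is [gamma + l1 d - l1 delta]. For [d = 1] it is strictly
     positive because [delta] differs from the intercept. *)
  have D0 : 0 <= l1 * (intercept K vs 0 - delta%:R).
    by rewrite mulr_ge0 ?subr_ge0 // ltW.
  apply: (@outer_conclusion _ _ _ _ _ _ deg_p _ _ l1) => //.
  + by apply: vq; exact: ltnW.
  + by move=> u; exact: edge.
  + by rewrite /l1 in D0 *; lra.
  case: hd => [d2|[d1 dT]].
    by rewrite -(ler_nat K) in d2; rewrite /l1 in D0 *; lra.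
  have : 0 < l1 * (intercept K vs 0 - delta%:R).
    rewrite mulr_gt0 // subr_gt0 lt_neqAle T1 andbT; apply/eqP; exact: dT.
  by rewrite d1 /l1 in TE *; lra.
- move=> k l2 sz Tk hd; have last := supp_last vs_q sz.
  have kv : (k.+1 < size vs)%N by rewrite sz.
  have TE := rT k kv; have l20 : 0 < l2 := r0 k kv; have pE := prevE k kv.
  have [n0 _] := ltv k k.+1 (ltnSn k) kv.
  (* With [l1 = 0], the bound [gamma >= 1] yields the surplus for the boundary [|w| = R]. *)
  have {}n0 : 1 <= (vtx_n vs k.+1)%:R :> K.
    by rewrite ler1n; exact: leq_ltn_trans n0.
  have d1 : (1 <= vtx_m vs k.+1)%N by case: hd => [/ltnW//|[->]].
  have E0 : 0 <= l2 * (delta%:R - intercept K vs k).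
    by rewrite mulr_ge0 ?subr_ge0 // ltW.
  apply: (@inner_conclusion _ _ _ _ _ _ deg_p _ _ 0 l2) => //.
  + exact: vq.
  + by move=> R R0 z w; rewrite /= powRr0 mulr1 subr0.
  + by move=> u uq; rewrite !mul0r !addr0 ler_nat last.
  + by move=> u uq; rewrite pE; exact: edge.
  + by rewrite !mul0r addr0 ler0n.
  + by rewrite -(ler_nat K) in d1; lra.
  + by rewrite pE /l2 in E0 *; lra.
  case: hd => [d2|[d1' dT]].
    by rewrite -(ler_nat K) in d2; rewrite pE /l2 in E0 *; lra.
  have : 0 < l2 * (delta%:R - intercept K vs k).
    rewrite mulr_gt0 // subr_gt0 lt_neqAle Tk andbT.
    by apply/eqP => /esym; exact: dT.
  by rewrite pE d1' /l2; lra.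
move=> k l1 l2 sz Tk Tk1 hd; have kv : (k.+1 < size vs)%N := ltnW sz.
have TE := rT k kv; have TE1 := rT k.+1 sz; have pE := prevE k kv.
pose l := Defs.ratio K vs k; rewrite -/l in TE pE.
have l0 : 0 < l := r0 k kv; have l10 : 0 < l1 := r0 k.+1 sz.
have l1l : l1 < l by exact: (ratio_decr vs_q sz).
have d1 : (1 <= vtx_m vs k.+1)%N by case: hd => [/ltnW//|[->]].
(* The edge to the right of the vertex gives [l1] and the surplus [D0]; the edge to its left gives
   [l = l1 + l2] and [E0]. *)
have D0 : 0 <= l1 * (intercept K vs k.+1 - delta%:R).
  by rewrite mulr_ge0 ?subr_ge0 // ltW.
have E0 : 0 <= l * (delta%:R - intercept K vs k).
  by rewrite mulr_ge0 ?subr_ge0 // ltW.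
apply: (@inner_conclusion _ _ _ _ _ _ deg_p _ _ l1 l) => //.
- exact: vq.
- by move=> R R0 z w; rewrite /= /l2 addrCA subrr addr0.
- exact: ltW.
- by move=> u; exact: edge.
- by move=> u uq; rewrite pE; exact: edge.
- by rewrite /l1 in D0 *; lra.
- case: hd => [d2|[d1' dT]].
    by rewrite -(ler_nat K) in d2; rewrite /l1 in D0 *; lra.
  have : 0 < l1 * (intercept K vs k.+1 - delta%:R).
    rewrite mulr_gt0 // subr_gt0 lt_neqAle Tk1 andbT; apply/eqP; exact: dT.
  by rewrite d1' in TE1 *; rewrite /l1; lra.
- by rewrite pE; lra.
case: hd => [d2|[d1' dT]].
  by rewrite -(ler_nat K) in d2; rewrite pE; lra.
have : 0 < l * (delta%:R - intercept K vs k).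
  rewrite mulr_gt0 // subr_gt0 lt_neqAle Tk andbT.
  by apply/eqP => /esym; exact: dT.
by rewrite pE d1'; lra.
Qed.
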